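(* Let $\alpha,\beta\in\overline{\mathbb{Q}_2}\setminus\{0\}$ be such that $\frac{\alpha}{\beta}\in\mathbb{Q}\setminus\{-2,-\frac{1}{2}\}$. Then $T(\alpha)\cap T(\beta)=\emptyset$. Moreover, for every $a\in\overline{\mathbb{Q}_2}\setminus\{0\}$ we have $T(a)\cap T(-2a)=\{-a^3\}$.
   Context: $\mathbb{C}_2$ denotes the completion of $\overline{\mathbb{Q}_2}$ with respect to the $2$-adic absolute value; $\mathbb{Q}$ is viewed inside $\mathbb{Q}_2\subset\overline{\mathbb{Q}_2}\subset\mathbb{C}_2$. For $\lambda\in\mathbb{C}_2\setminus\{0\}$ let $E_\lambda: y^2=x^3+\lambda$ and let $f_\lambda(z)=\frac{z^4-8\lambda z}{4(z^3+\lambda)}$ be the Lattès map on $\mathbb{P}^1(\mathbb{C}_2)$ induced by multiplication by $2$ on $E_\lambda$ (via the $x$-coordinate). For $\alpha\in\mathbb{C}_2\setminus\{0\}$, $T(\alpha)=\{\lambda\in\mathbb{C}_2\setminus\{0\} : (\alpha,\sqrt{\alpha^3+\lambda}) \text{ is torsion on } E_\lambda\}=\{\lambda\in\mathbb{C}_2\setminus\{0\}: \alpha \text{ is preperiodic for } f_\lambda\}$.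
   Formalization: The first claim is proved under the additional assumption that α and β are distinct, since for α = β the set T(α)∩T(β) = T(α) contains −α³ and is never empty. *)

(* Defs.v *)
From HB Require Import structures.
From mathcomp Require Import all_boot all_order all_algebra.
From mathcomp Require Import all_classical all_reals.

Set Implicit Arguments.
Unset Strict Implicit.
Unset Printing Implicit Defensive.

Import Order.TTheory GRing.Theory Num.Theory.

Local Open Scope ring_scope.

(* MathComp's normed structures require `|x *+ n| = `|x| *+ n, which fails for
   the p-adic absolute values, so absolute values are plain functions here. *)
Record nonarch_absolute_value (R : realType) (K : fieldType) (v : K -> R) :
    Prop := NonarchAbsoluteValue {
  nav_ge0 : forall x, 0 <= v x;
  nav_eq0 : forall x, v x = 0 <-> x = 0;
  navM : forall x y, v (x * y) = v x * v y;
  nav_ultra : forall x y, v (x + y) <= Num.max (v x) (v y)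
}.

(* p ^ (- ord_p x) for x != 0. *)
Definition padic_abs (R : realType) (p : nat) (x : rat) : R :=
  if x == 0 then 0
  else p%:R ^ ((logn p `|denq x|%N)%:Z - (logn p `|numq x|%N)%:Z).

Section Completion.
Variables (R : realType) (K L : fieldType).

Definition cauchy_for (w : L -> R) (u : nat -> L) : Prop :=
  forall e : R, 0 < e -> exists N : nat, forall m n : nat,
    (N <= m)%N -> (N <= n)%N -> w (u m - u n) < e.

Definition converges_for (w : L -> R) (u : nat -> L) (l : L) : Prop :=
  forall e : R, 0 < e -> exists N : nat, forall n : nat,
    (N <= n)%N -> w (u n - l) < e.

Record is_completion (v : K -> R) (w : L -> R) (i : {rmorphism K -> L}) :
    Prop := IsCompletion {
  completion_abs : nonarch_absolute_value w;
  completion_isometry : forall x, w (i x) = v x;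
  completion_dense : forall (y : L) (e : R), 0 < e ->
    exists x : K, w (y - i x) < e;
  completion_complete : forall u : nat -> L, cauchy_for w u ->
    exists l : L, converges_for w u l
}.

End Completion.

(* L is algebraically closed by its type; the absolute value w on L is the one
   extending v, unique when K is complete for v. *)
Record is_valued_algebraic_closure (R : realType) (K : fieldType)
    (L : closedFieldType) (v : K -> R) (w : L -> R) (i : {rmorphism K -> L}) :
    Prop := IsValuedAlgebraicClosure {
  closure_algebraic : forall y : L, algebraicOver i y;
  closure_abs : nonarch_absolute_value w;
  closure_extends : forall x, w (i x) = v x
}.

Definition preperiodic (X : Type) (f : X -> X) (x : X) : Prop :=
  exists m n : nat, (m < n)%N /\ iter m f x = iter n f x.

(* The projective line over K is option K, with None the point at infinity.
   For lambda != 0 in characteristic 0, numerator and denominator have no common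
   zero, so zeros of the denominator are genuine poles. *)
Definition lattes (K : fieldType) (lambda : K) (P : option K) : option K :=
  if P is Some z then
    if z ^+ 3 + lambda == 0 then None
    else Some ((z ^+ 4 - 8 * lambda * z) / (4 * (z ^+ 3 + lambda)))
  else None.

Definition T (K : fieldType) (alpha : K) : set K :=
  [set lambda | lambda <> 0 /\ preperiodic (lattes lambda) (Some alpha)]%classic.

(* Main.v *)
Require Import Defs.
From HB Require Import structures.
From mathcomp Require Import all_boot all_order all_algebra.
From mathcomp Require Import all_classical all_reals.
From mathcomp Require Import ring lra zify.

Set Implicit Arguments.
Unset Strict Implicit.
Unset Printing Implicit Defensive.

Import Order.TTheory GRing.Theory Num.Theory.

Local Open Scope classical_set_scope.
Local Open Scope ring_scope.

(* On [t = z ^+ 3 / lambda] the Lattes map induces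
   [t |-> t * (t - 8) ^+ 3 / (4 * (t + 1)) ^+ 3], independent of [lambda].
   Orbits with [|t| >= 1] escape unless [t = -1], and orbits with [|t| <= 1 / 8]
   are attracted to 0 without reaching it unless [t = 0] or [t = 8].  Hence
   nonzero preperiodic points satisfy [t = -1], [t = 8] or [1 / 8 < |t| < 1].
   For rational [q], [|q| ^+ 3] is a power of 8, so if [t] and [q ^+ 3 * t] are
   both preperiodic, either they are [-1] and [8] in some order (and [q] is [-2]
   or [- (1 / 2)]), or [|q| = 1].  In the latter case the points agree up to a
   relative error at most [1 / 2], because [q] is a quotient of odd integers; as
   long as [|t| ^+ 2 < 1 / 8] the map shrinks a nonzero relative error strictly,
   without killing it, which is impossible for a preperiodic pair.  If
   [|t| ^+ 2 > 1 / 8] the next iterate escapes, and if [|t| ^+ 2 = 1 / 8] both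
   points map to -1, hence are roots of [X ^+ 2 + 20 * X - 8], which are too far
   apart. *)

(** * Preperiodic points of arbitrary self-maps *)

Section Preperiodic.
Variables (X Y : Type) (f : X -> X) (g : Y -> Y).

Lemma preperiodic_step (x : X) : preperiodic f x -> preperiodic f (f x).
Proof. by case=> m [n [mn E]]; exists m, n; rewrite -!iterSr !iterS E. Qed.

Lemma preperiodic_semiconj (h : X -> Y) (x : X) :
  (forall x, h (f x) = g (h x)) -> preperiodic f x -> preperiodic g (h x).
Proof.
move=> hfg [m [n [mn E]]]; exists m, n; split=> //.
by have iterh k : iter k g (h x) = h (iter k f x);
  [elim: k => //= k ->; rewrite hfg | rewrite !iterh E].
Qed.

Lemma preperiodicP (x : X) : preperiodic f x -> exists N d : nat, (0 < d)%N /\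
  forall M k : nat, (N <= M)%N -> iter (M + k * d) f x = iter M f x.
Proof.
case=> m [n [mn E]]; exists m, (n - m)%N; split; first by rewrite subn_gt0.
move=> M k mM; elim: k => [|k IH]; first by rewrite addn0.
have -> : (M + k.+1 * (n - m) = (M - m + k * (n - m)) + n)%N by nia.
by rewrite iterD -E -iterD -IH; congr (iter _ f x); nia.
Qed.

(** Strict growth of [h] keeps the iterates distinct. Escape, attraction and contraction of pairs
    are all excluded through this. *)
Lemma preperiodic_monovariant (R : realType) (P : X -> Prop) (h : X -> R)
    (x : X) :
  (forall x, P x -> P (f x) /\ h x < h (f x)) -> P x -> ~ preperiodic f x.
Proof.
move=> step Px [m [n [mn E]]].
have PI k : P (iter k f x) by elim: k => //= k Pk; exact: (step _ Pk).1.
have mono k : h (iter m f x) < h (iter (k.+1 + m) f x).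
  elim: k => [|k IH]; first exact: (step _ (PI m)).2.
  exact: lt_trans IH (step _ (PI _)).2.
have := mono (n - m).-1; rewrite prednK ?subn_gt0// subnK ?(ltnW mn)// E.
by rewrite ltxx.
Qed.

End Preperiodic.

(** The sum of the preperiods and the product of the periods serve both orbits. *)
Lemma preperiodic_pair (X Y : Type) (f : X -> X) (g : Y -> Y) (x : X) (y : Y) :
  preperiodic f x -> preperiodic g y ->
  preperiodic (fun p => (f p.1, g p.2)) (x, y).
Proof.
move=> px py; have [N [d [d0 Ex]]] := preperiodicP px.
have [N' [d' [d0' Ey]]] := preperiodicP py.
have iterp k : iter k (fun p => (f p.1, g p.2)) (x, y) = (iter k f x, iter k g y).
  by elim: k => //= k ->.
exists (N + N')%N, (N + N' + d * d')%N; split.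
  by rewrite -[ltnLHS]addn0 ltn_add2l muln_gt0 d0.
by rewrite !iterp Ey ?leq_addl// mulnC Ex ?leq_addr.
Qed.

(** * Reduction to a map independent of [lambda] *)

(** This is [lattes 1] read in the coordinate [z ^+ 3], that is, modulo cube roots of unity; cubing
    avoids choosing a cube root of [lambda]. *)
Definition cube_lattes (K : fieldType) (P : option K) : option K :=
  if P is Some t then
    if t + 1 == 0 then None
    else Some (t * (t - 8) ^+ 3 / (4 * (t + 1)) ^+ 3)
  else None.

Definition cube_ratio (K : fieldType) (lambda : K) (P : option K) : option K :=
  if P is Some z then Some (z ^+ 3 / lambda) else None.

Lemma cube_ratio_lattes (K : fieldType) (lambda : K) (P : option K) :
  lambda != 0 ->
  cube_ratio lambda (lattes lambda P) = cube_lattes (cube_ratio lambda P).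
Proof.
move=> l0; case: P => //= z.
have -> : z ^+ 3 / lambda + 1 = (z ^+ 3 + lambda) / lambda by field.
rewrite mulf_eq0 invr_eq0 (negPf l0) orbF; case: eqVneq => //= zl.
congr Some.
(* In characteristic 2 both sides have denominator 0, so both are 0 by the convention on
   inverses. *)
have [->|n4] := eqVneq (4 : K) 0; last first.
  by field; rewrite l0 zl n4.
by rewrite !mul0r invr0 !mulr0 !expr0n invr0 mulr0 mul0r.
Qed.

(** * Nonarchimedean absolute values *)

Section NonarchimedeanAbsoluteValue.
Variables (R : realType) (K : fieldType) (v : K -> R).
Hypothesis vabs : nonarch_absolute_value v.

Let v_ge0 := nav_ge0 vabs.
Let vM := navM vabs.

Lemma nav0 : v 0 = 0. Proof. exact/(nav_eq0 vabs). Qed.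

Lemma nav_gt0 (x : K) : x != 0 -> 0 < v x.
Proof.
by move=> x0; rewrite lt0r v_ge0 andbT; apply: contra_neq x0 => /(nav_eq0 vabs).
Qed.

Lemma nav_neq0 (x : K) : 0 < v x -> x != 0.
Proof. by apply: contraTneq => ->; rewrite nav0 ltxx. Qed.

Lemma nav1 : v 1 = 1.
Proof.
have v1 := nav_gt0 (oner_neq0 K).
by apply: (mulIf (lt0r_neq0 v1)); rewrite -vM !mul1r.
Qed.

Lemma navX (x : K) (n : nat) : v (x ^+ n) = v x ^+ n.
Proof. by elim: n => [|n IH]; rewrite ?expr0 ?nav1// !exprS vM IH. Qed.

Lemma navN (x : K) : v (- x) = v x.
Proof.
have vN1 : v (-1) = 1.
  have /eqP := navX (-1) 2; rewrite sqrrN expr1n nav1 eq_sym sqrf_eq1.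
  by case/orP=> /eqP //; have := v_ge0 (-1); lra.
by rewrite -mulN1r vM vN1 mul1r.
Qed.

Lemma navV (x : K) : v x^-1 = (v x)^-1.
Proof.
have [->|x0] := eqVneq x 0; first by rewrite invr0 nav0 invr0.
apply: (mulIf (lt0r_neq0 (nav_gt0 x0))).
by rewrite -vM mulVf ?nav1 ?mulVf// gt_eqF ?nav_gt0.
Qed.

Lemma nav_div (x y : K) : v (x / y) = v x / v y.
Proof. by rewrite vM navV. Qed.

Lemma nav_ltD (c : R) (x y : K) : v x < c -> v y < c -> v (x + y) < c.
Proof.
by move=> xc yc; apply: le_lt_trans (nav_ultra vabs _ _) _; rewrite gt_max xc.
Qed.

Lemma nav_leD (c : R) (x y : K) : v x <= c -> v y <= c -> v (x + y) <= c.
Proof.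
by move=> xc yc; apply: le_trans (nav_ultra vabs _ _) _; rewrite ge_max xc.
Qed.

(** Otherwise [x = (x + y) - y] would be a sum of two terms smaller than [x]. *)
Lemma navDl (x y : K) : v y < v x -> v (x + y) = v x.
Proof.
move=> yx; apply/eqP; rewrite eq_le nav_leD ?(ltW yx)//= leNgt; apply/negP => xyx.
have Nyx : v (- y) < v x by rewrite navN.
by have := nav_ltD xyx Nyx; rewrite addrK ltxx.
Qed.

Lemma nav_nat (n : nat) : v n%:R <= 1.
Proof.
elim: n => [|n IH]; first by rewrite nav0.
by rewrite -natr1 nav_leD ?nav1.
Qed.

Lemma nav_int (z : int) : v z%:~R <= 1.
Proof. by case: z => n; rewrite ?NegzE ?mulrNz ?navN nav_nat. Qed.

Section Dyadic.
Hypothesis v2 : v 2 = 1 / 2.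

Lemma nav_odd (z : int) : v (2 * z + 1)%:~R = 1.
Proof.
rewrite intrD intrM addrC navDl ?nav1// vM v2.
by have := nav_int z; lra.
Qed.

Lemma nav4 : v 4 = 1 / 4.
Proof. by rewrite (_ : 4 = 2 ^+ 2) ?navX ?v2; [field | ring]. Qed.

Lemma four_neq0 : 4 != 0 :> K.
Proof. by rewrite nav_neq0// nav4; lra. Qed.

Lemma nav8 : v 8 = 1 / 8.
Proof. by rewrite (_ : 8 = 2 ^+ 3) ?navX ?v2; [field | ring]. Qed.

Lemma nav3 : v 3 = 1.
Proof. exact: (nav_odd 1). Qed.

(** The cases are: even numerator, even denominator, both odd. In the last, [q - 1] is an even
    integer over an odd one. *)
Lemma nav_rat (i : {rmorphism rat -> K}) (q : rat) :
  [\/ v (i q) <= 1 / 2, 2 <= v (i q) | v (i q) = 1 /\ v (i q - 1) <= 1 / 2].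
Proof.
have iE : i q = (numq q)%:~R / (denq q)%:~R.
  by rewrite -[in LHS](divq_num_den q) fmorph_div !rmorph_int.
have even (z : int) : v (2 * z)%:~R <= 1 / 2.
  by rewrite intrM vM v2; have := nav_int z; lra.
have parity (z : int) : exists y : int, z = 2 * y \/ z = 2 * y + 1.
  by exists (z %/ 2)%Z; lia.
have [a [aE|aE]] := parity (numq q); have [b [bE|bE]] := parity (denq q).
- by have := coprime_num_den q; rewrite aE bE !abszM coprimeMl !coprimeMr.
- by constructor 1; rewrite iE aE bE nav_div nav_odd divr1 even.
- constructor 2; rewrite iE aE nav_div nav_odd div1r.
  have den0 : 0 < v (denq q)%:~R.
    by apply: nav_gt0; rewrite -(rmorph_int i) fmorph_eq0 intr_eq0 denq_neq0.
  by rewrite -[leLHS]invrK lef_pV2 ?posrE ?invr_gt0// bE; have := even b; lra.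
- constructor 3; rewrite iE aE bE nav_div !nav_odd divr1; split=> //.
  have den0 : (2 * b + 1)%:~R != 0 :> K by rewrite nav_neq0 ?nav_odd.
  rewrite -[X in _ - X](divff den0) -mulrBl -intrB nav_div nav_odd divr1.
  by rewrite (_ : _ - _ = 2 * (a - b)) ?even//; ring.
Qed.

(** * Sizes of preperiodic points *)

Local Notation cube_lattes := (@cube_lattes K).

Lemma nav_sub8 (t : K) : 1 / 8 < v t -> v (t - 8) = v t.
Proof. by move=> t8; rewrite navDl// navN nav8. Qed.

Lemma nav_add1 (t : K) : v t < 1 -> v (t + 1) = 1.
Proof. by move=> t1; rewrite addrC navDl// nav1. Qed.

Lemma nav_cube_lattes (t : K) :
  v (t * (t - 8) ^+ 3 / (4 * (t + 1)) ^+ 3) =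
  64 * (v t * v (t - 8) ^+ 3) / v (t + 1) ^+ 3.
Proof.
rewrite nav_div !(vM, navX) nav4 (_ : (1 / 4 * _) ^+ 3 = v (t + 1) ^+ 3 / 64).
  by rewrite invf_div; ring.
by field.
Qed.

(** If [t] is not -1, then [v (t - 8) = v t] and [v (t + 1) <= v t], so each step multiplies the
    size by at least 64; the image then has size above 1 and again differs from -1. *)
Lemma preperiodic_cube_ge1 (t : K) :
  1 <= v t -> preperiodic cube_lattes (Some t) -> t = -1.
Proof.
move=> t1 pt; apply: contrapT => tN1; move: pt.
pose h P := if P is Some t then v t else 0 : R.
apply: (@preperiodic_monovariant _ _ R
  (fun P => if P is Some t then 1 <= v t /\ t <> -1 else False) h); last by [].
case=> [z|] [] // z1 zN1 /=.
have z10 : z + 1 != 0 by rewrite addr_eq0; apply/eqP.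
rewrite (negPf z10) /=.
have vz1 : 0 < v (z + 1) by rewrite nav_gt0.
have vz1z : v (z + 1) <= v z by rewrite nav_leD ?nav1.
have : 64 * v z <= v (z * (z - 8) ^+ 3 / (4 * (z + 1)) ^+ 3).
  rewrite nav_cube_lattes nav_sub8; last lra.
  rewrite ler_pdivlMr ?exprn_gt0// -mulrA ler_pM2l; last lra.
  by rewrite ler_pM2l ?lerXn2r ?nnegrE ?v_ge0//; lra.
set w := _ / _ => wz; split; last lra.
split; first lra.
by move=> wN1; move: wz; rewrite wN1 navN nav1; lra.
Qed.

(** Here [v (t - 8) = 1 / 8], so each step divides the size by exactly 8. *)
Lemma preperiodic_cube_lt8 (t : K) :
  v t < 1 / 8 -> preperiodic cube_lattes (Some t) -> t = 0.
Proof.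
move=> t8 pt; apply: contrapT => tN0; move: pt.
pose h P := if P is Some t then - v t else 0 : R.
apply: (@preperiodic_monovariant _ _ R
  (fun P => if P is Some t then v t < 1 / 8 /\ 0 < v t else False) h); last first.
  by split=> //; apply: nav_gt0; apply/eqP.
case=> [z|] [] // z8 z0 /=.
have vz1 : v (z + 1) = 1 by rewrite nav_add1//; lra.
have z10 : z + 1 != 0 by rewrite nav_neq0 ?vz1.
rewrite (negPf z10) /= nav_cube_lattes vz1 addrC navDl ?navN ?nav8//.
by split; [split|]; lra.
Qed.

(** The image has size at most 1 / 64, hence is 0, and [t = 8] is the only nonzero preimage of 0. *)
Lemma preperiodic_cube_eq8 (t : K) :
  v t = 1 / 8 -> preperiodic cube_lattes (Some t) -> t = 8.
Proof.
move=> t8 pt; have := preperiodic_step pt; rewrite /=.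
have vt1 : v (t + 1) = 1 by rewrite nav_add1//; lra.
have t10 : t + 1 != 0 by rewrite nav_neq0 ?vt1.
rewrite (negPf t10) => /preperiodic_cube_lt8 gt0.
have /eqP : t * (t - 8) ^+ 3 / (4 * (t + 1)) ^+ 3 = 0.
  apply: gt0; rewrite nav_cube_lattes vt1 t8.
  have : v (t - 8) <= 1 / 8 by rewrite nav_leD ?navN ?nav8 ?t8.
  have := v_ge0 (t - 8); set w := v (t - 8) => w0 w8.
  have : w ^+ 3 <= (1 / 8) ^+ 3 by rewrite lerXn2r ?nnegrE//; lra.
  lra.
have tn0 : t != 0 by rewrite nav_neq0// t8; lra.
rewrite mulf_eq0 invr_eq0 mulf_eq0 !expf_eq0/= (negPf tn0) mulf_eq0 (negPf t10).
by rewrite orbF subr_eq0 (negPf four_neq0) orbF => /eqP.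
Qed.

Lemma preperiodic_cube_range (t : K) :
  t != 0 -> preperiodic cube_lattes (Some t) ->
  [\/ t = -1, t = 8 | 1 / 8 < v t < 1].
Proof.
move=> tn0 pt; have [t1|t1] := leP 1 (v t).
  by constructor 1; apply: preperiodic_cube_ge1.
have [t8|t8|t8] := ltrgtP (v t) (1 / 8).
- by move: tn0; rewrite (preperiodic_cube_lt8 t8 pt) eqxx.
- by constructor 3.
- by constructor 2; apply: preperiodic_cube_eq8.
Qed.


(** * Pairs of nearby preperiodic points *)

(** The value -1 is taken doubly: clearing denominators gives the square of this quadratic. *)
Lemma cube_lattes_eqN1 (t : K) :
  cube_lattes (Some t) = Some (-1) -> t ^+ 2 + 20 * t - 8 = 0.
Proof.
rewrite /=; case: eqVneq => // t10 [].
have n0 : (4 * (t + 1)) ^+ 3 != 0 by rewrite expf_neq0 ?mulf_neq0 ?four_neq0.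
move/(canRL (divfK n0)); rewrite mulN1r => E.
apply/eqP; rewrite -sqrf_eq0; apply/eqP.
transitivity (t * (t - 8) ^+ 3 + (4 * (t + 1)) ^+ 3); first by ring.
by rewrite E addNr.
Qed.

(* If [t <> s] are the two roots of [X ^+ 2 + 20 * X - 8], then
   [(s - t) ^+ 2 = 432] has absolute value [1 / 16]. *)
Lemma cube_lattes_eqN1_far (t s : K) : t != s -> v t ^+ 2 = 1 / 8 ->
  cube_lattes (Some t) = Some (-1) -> cube_lattes (Some s) = Some (-1) ->
  v t / 2 < v (s - t).
Proof.
move=> ts vt /cube_lattes_eqN1 Et /cube_lattes_eqN1 Es.
have sE : s = - t - 20.
  have /eqP : (s - t) * (s + t + 20) = 0.
    by rewrite -[RHS](subrr 0) -{1}Es -Et; ring.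
  rewrite mulf_eq0 subr_eq0 eq_sym (negPf ts)/= => /eqP E.
  by rewrite -[LHS]subr0 -E; ring.
have dE : (s - t) ^+ 2 = 4 ^+ 2 * (2 * 13 + 1)%:~R.
  have -> : (s - t) ^+ 2 = 4 * (t ^+ 2 + 20 * t - 8) + 432 by rewrite sE; ring.
  by rewrite Et; ring.
have := congr1 v dE; rewrite navX vM navX nav4 nav_odd => vd.
rewrite -ltr_sqr ?nnegrE ?v_ge0 ?divr_ge0//.
by rewrite vd expr_div_n vt; lra.
Qed.


Let G (t : K) : K := t * (t - 8) ^+ 3 / (4 * (t + 1)) ^+ 3.

(** The relative error gets multiplied by [1 / (8 * v t)], which is below 1. This is read off the
    part of [G s / G t - 1] that is linear in the errors of the factors. *)
Lemma cube_lattes_contract (t s : K) :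
  t != s -> v (s - t) <= v t / 2 -> 1 / 8 < v t -> v t ^+ 2 < 1 / 8 ->
  v (G s - G t) = v (G t) * (v (s - t) / v t / (8 * v t)).
Proof.
move=> ts std t8 t2.
have tlt : v t < 1 / 2 by rewrite -ltr_sqr ?nnegrE ?v_ge0//; lra.
have t0 : t != 0 by rewrite nav_neq0//; lra.
have vs : v s = v t by rewrite -[s](subrK t) addrC navDl//; lra.
have vt1 : v (t + 1) = 1 by rewrite nav_add1//; lra.
have vs1 : v (s + 1) = 1 by rewrite nav_add1//; lra.
have vt8 : v (t - 8) = v t by rewrite nav_sub8.
have t10 : t + 1 != 0 by rewrite nav_neq0 ?vt1.
have s10 : s + 1 != 0 by rewrite nav_neq0 ?vs1.
have t80 : t - 8 != 0 by rewrite nav_neq0 ?vt8//; lra.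
(* [1 + delta] is [s / t], and [1 + rho] is the ratio of [(s - 8) / (s + 1)] to
   [(t - 8) / (t + 1)]. *)
pose delta := (s - t) / t; pose rho := 9 * (s - t) / ((t - 8) * (s + 1)).
have vdelta : v delta = v (s - t) / v t by rewrite nav_div.
have vrho : v rho = v delta.
  rewrite !(nav_div, vM) vt8 vs1 mulr1 (_ : 9 = 3 * 3) ?vM ?nav3 ?mul1r//.
  by ring.
have GE : G s - G t = G t * ((1 + delta) * (1 + rho) ^+ 3 - 1).
  by rewrite /G /delta /rho; field; rewrite t0 t10 s10 t80 four_neq0.
pose A := delta + 3 * rho.
have vA : v A = v delta / (8 * v t).
  (* In the numerator -8 dominates; for the term [t * s] this is exactly [v t ^+ 2 < 1 / 8]. *)
  have -> : A = delta * ((- 8 + (t * s - 8 * s + 4 * 7 * t)) / ((t - 8) * (s + 1))).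
    by rewrite /A /delta /rho; field; rewrite t0 s10 t80.
  rewrite vM; congr (_ * _); rewrite nav_div (vM (t - 8)) vt8 vs1 mulr1 navDl.
    by rewrite navN nav8; field; lra.
  rewrite navN nav8; apply: nav_ltD; first apply: nav_ltD.
  - by rewrite vM vs -expr2.
  - by rewrite navN vM nav8 vs; lra.
  - by rewrite !vM nav4 (nav_odd 3); lra.
have d0 : 0 < v delta by rewrite vdelta divr_gt0// nav_gt0// subr_eq0 eq_sym.
have d2 : v delta <= 1 / 2 by rewrite vdelta ler_pdivrMr; lra.
have dA : v delta / 4 < v A.
  by rewrite vA ltr_pM2l// -[ltLHS]invrK ?ltf_pV2 ?posrE; lra.
rewrite GE vM; congr (_ * _); rewrite -vdelta -vA.
(* [A] dominates the other terms, which are at least quadratic in [delta], [rho]. *)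
have -> : (1 + delta) * (1 + rho) ^+ 3 - 1 =
    A + (A * rho * (3 + rho) + 2 * rho * (rho * (delta - rho - 3))
         + delta * rho ^+ 3).
  by rewrite /A; ring.
clearbody A rho delta.
rewrite navDl//; apply: nav_ltD; first apply: nav_ltD.
- rewrite !vM vrho -mulrA gtr_pMr; last lra.
  have : v (3 + rho) <= 1 by rewrite nav_leD ?nav3 ?vrho//; lra.
  by have := v_ge0 (3 + rho); nra.
- rewrite !vM v2 vrho; apply: le_lt_trans dA.
  have : v (delta - rho - 3) <= 1.
    by rewrite !nav_leD ?navN ?nav3 ?vrho//; lra.
  have := v_ge0 (delta - rho - 3); set X := v (_ - 3) => X0 X1.
  have dX : v delta * X <= 1 / 2 by nra.
  by nra.
- rewrite vM navX vrho; apply: le_lt_trans dA.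
  have d3 : v delta ^+ 3 <= (1 / 2) ^+ 3 by rewrite lerXn2r ?nnegrE ?v_ge0//; lra.
  by nra.
Qed.

Lemma nav_cube_lattes_mid (t : K) : 1 / 8 < v t < 1 -> v (G t) = 64 * v t ^+ 4.
Proof.
case/andP=> t8 t1.
by rewrite /G nav_cube_lattes nav_sub8// nav_add1// expr1n divr1 -exprS.
Qed.

Lemma cube_lattesE (t : K) : v t < 1 -> cube_lattes (Some t) = Some (G t).
Proof. by move=> t1; rewrite /= ifN// nav_neq0// nav_add1. Qed.

Lemma preperiodic_cube_close (t s : K) :
  t != 0 -> v (s - t) <= v t / 2 ->
  preperiodic cube_lattes (Some t) -> preperiodic cube_lattes (Some s) -> s = t.
Proof.
move=> t0 st pt ps; apply/eqP; apply: contraT; rewrite eq_sym => ts.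
have := preperiodic_pair pt ps.
(* Preperiodicity belongs to the invariant so that the size constraints apply anew at every step. *)
pose P (p : option K * option K) := if p is (Some t, Some s) then
  [/\ t != 0, t != s, v (s - t) <= v t / 2,
    preperiodic cube_lattes (Some t) & preperiodic cube_lattes (Some s)]
  else False.
pose h (p : option K * option K) :=
  if p is (Some t, Some s) then - (v (s - t) / v t) else 0.
suff step p : P p -> P (cube_lattes p.1, cube_lattes p.2) /\
    h p < h (cube_lattes p.1, cube_lattes p.2).
  by move/(preperiodic_monovariant step) => [].
clear t s t0 st pt ps ts.
case: p => [[t|] [s|]] //= [t0 ts std pt ps].
have vt0 := nav_gt0 t0.
have vs : v s = v t by rewrite -[s](subrK t) addrC navDl//; lra.
have [tE|tE|/[dup] tmid /andP[t8 t1]] := preperiodic_cube_range t0 pt.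
- move: ts; rewrite tE (@preperiodic_cube_ge1 s) ?eqxx//.
  by rewrite vs tE navN nav1.
- by move: ts; rewrite tE (@preperiodic_cube_eq8 s) ?eqxx// vs tE nav8.
have s1 : v s < 1 by rewrite vs.
have smid : 1 / 8 < v s < 1 by rewrite vs.
rewrite -!/(cube_lattes (Some _)) !cube_lattesE//.
have pGt : preperiodic cube_lattes (Some (G t)).
  by rewrite -cube_lattesE//; apply: preperiodic_step.
have pGs : preperiodic cube_lattes (Some (G s)).
  by rewrite -cube_lattesE//; apply: preperiodic_step.
have vGt := nav_cube_lattes_mid tmid; have vGs := nav_cube_lattes_mid smid.
have vt4 : v t ^+ 4 = (v t ^+ 2) ^+ 2 by rewrite -exprM.
(* Since [v (G t) = 64 * v t ^+ 4], this compares [v (G t)] with 1. *)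
have [t2|t2|t2] := ltrgtP (v t ^+ 2) (1 / 8).
- have cG := cube_lattes_contract ts std t8 t2.
  have d0 : 0 < v (s - t) / v t.
    by rewrite divr_gt0// nav_gt0// subr_eq0 eq_sym.
  have d2 : v (s - t) / v t <= 1 / 2 by rewrite ler_pdivrMr//; lra.
  have vGt0 : 0 < v (G t) by rewrite vGt mulr_gt0 ?exprn_gt0//; lra.
  have dlt : v (s - t) / v t / (8 * v t) < v (s - t) / v t.
    by rewrite ltr_pdivrMr ?ltr_pMr//; lra.
  have d'0 : 0 < v (s - t) / v t / (8 * v t) by rewrite divr_gt0//; lra.
  rewrite /= cG [v (G t) * _]mulrC mulfK ?gt_eqF// ltrN2; split=> //.
  split=> //; first exact: nav_neq0.
    by rewrite eq_sym -subr_eq0 nav_neq0// cG mulr_gt0.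
  by rewrite [leLHS]mulrC ler_pM2l//; lra.
- have G1 : 1 < v (G t).
    have : (1 / 8) ^+ 2 < (v t ^+ 2) ^+ 2 by rewrite ltrXn2r ?nnegrE ?sqr_ge0//; lra.
    by rewrite vGt vt4; lra.
  by have GN1 := preperiodic_cube_ge1 (ltW G1) pGt; rewrite GN1 navN nav1 ltxx in G1.
- have GtN1 : G t = -1.
    by apply: preperiodic_cube_ge1 pGt; rewrite vGt vt4 t2; lra.
  have GsN1 : G s = -1.
    by apply: preperiodic_cube_ge1 pGs; rewrite vGs vs vt4 t2; lra.
  have := cube_lattes_eqN1_far ts t2; rewrite !cube_lattesE// GtN1 GsN1.
  by move=> /(_ erefl erefl); lra.
Qed.

(** * Preperiodic points whose ratio is a cube *)

(** Nonzero preperiodic points have size between 1 / 8 and 1, while [v s] is at least [8 * v t];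
    both extremes are attained, so [s = -1] and [t = 8]. *)
Lemma preperiodic_cube_halve (x t s : K) :
  t != 0 -> s != 0 -> t = x ^+ 3 * s -> v x <= 1 / 2 ->
  preperiodic cube_lattes (Some t) -> preperiodic cube_lattes (Some s) ->
  s = -1 /\ x ^+ 3 = - 8.
Proof.
move=> t0 s0 tE x2 pt ps.
have vt : v t <= v s / 8.
  rewrite tE vM navX mulrC ler_pM2l ?nav_gt0//.
  have : v x ^+ 3 <= (1 / 2) ^+ 3 by rewrite lerXn2r ?nnegrE ?v_ge0//; lra.
  lra.
have t8 : 1 / 8 <= v t.
  case: (preperiodic_cube_range t0 pt) => [->|->|/andP[/ltW//]].
    by rewrite navN nav1; lra.
  by rewrite nav8.
have sE : s = -1 by apply: preperiodic_cube_ge1 ps; lra.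
have : t = 8.
  apply: preperiodic_cube_eq8 pt; apply/eqP; rewrite eq_le t8 andbT.
  by move: vt; rewrite sE navN nav1; lra.
by rewrite tE sE mulrN1 => <-; rewrite opprK.
Qed.

Lemma preperiodic_cube_rat (i : {rmorphism rat -> K}) (q : rat) (t s : K) :
  t != 0 -> s != 0 -> t = i q ^+ 3 * s ->
  preperiodic cube_lattes (Some t) -> preperiodic cube_lattes (Some s) ->
  [\/ q = 1, q = - 2 | q = - (1 / 2)].
Proof.
move=> t0 s0 tE pt ps.
have q0 : q != 0 by apply: contra_neq t0 => q0; rewrite tE q0 rmorph0 expr0n mul0r.
have cuberootN8 (r : rat) : i r ^+ 3 = - 8 -> r = - 2.
  move=> r8; have : i (r ^+ 3 + 8) = 0.
    by rewrite rmorphD rmorphXn r8 rmorph_nat addNr.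
  have -> : r ^+ 3 + 8 = (r + 2) * ((r - 1) ^+ 2 + 3) by ring.
  move/eqP; rewrite fmorph_eq0.
  rewrite mulf_eq0 addr_eq0 => /orP[/eqP//|/eqP r0].
  by have := sqr_ge0 (r - 1); lra.
have [q2|q2|[q1 q2]] := nav_rat i q.
- constructor 2; apply: cuberootN8.
  by case: (preperiodic_cube_halve t0 s0 tE q2 pt ps).
(* For [q] with even denominator, [t] and [s] exchange roles and [q^-1] replaces [q]. *)
- have sE : s = i q^-1 ^+ 3 * t.
    by rewrite tE fmorphV exprVn mulKf// expf_neq0// fmorph_eq0.
  have q2' : v (i q^-1) <= 1 / 2.
    by rewrite fmorphV navV div1r lef_pV2 ?posrE//; lra.
  constructor 3.
  have [_ /cuberootN8 qV] := preperiodic_cube_halve s0 t0 sE q2' ps pt.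
  by rewrite -[q]invrK qV; field.
- constructor 1.
  have ts : t = s.
    apply: preperiodic_cube_close => //.
    (* The factor [i q - 1] supplies the relative error 1 / 2. *)
    have -> : t - s = s * ((i q - 1) * (i q ^+ 2 + i q + 1)).
      by rewrite tE; ring.
    rewrite vM ler_pM2l ?nav_gt0// vM.
    have : v (i q ^+ 2 + i q + 1) <= 1 by rewrite !nav_leD ?navX ?nav1 ?q1 ?expr1n.
    by move=> le1; rewrite -[leRHS]mulr1 ler_pM ?v_ge0// -div1r.
  have : i (q ^+ 3 - 1) = 0.
    rewrite rmorphB rmorphXn rmorph1; apply: (mulIf s0).
    by rewrite mul0r mulrBl -tE ts mul1r subrr.
  have -> : q ^+ 3 - 1 = (q - 1) * ((q + 1 / 2) ^+ 2 + 3 / 4) by field.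
  move/eqP; rewrite fmorph_eq0.
  rewrite mulf_eq0 subr_eq0 => /orP[/eqP//|/eqP r0].
  by have := sqr_ge0 (q + 1 / 2); lra.
Qed.

End Dyadic.
End NonarchimedeanAbsoluteValue.

(** * Transfer to [T] and conclusion *)

Lemma T_cube_ratio (K : fieldType) (alpha lambda : K) :
  T alpha lambda -> lambda != 0 /\
    preperiodic (@cube_lattes K) (Some (alpha ^+ 3 / lambda)).
Proof.
case=> /eqP l0 pa; split=> //.
apply: (preperiodic_semiconj (h := cube_ratio lambda) _ pa) => P.
exact: cube_ratio_lattes.
Qed.

Lemma padic_abs2 (R : realType) : padic_abs R 2 2 = 1 / 2.
Proof.
rewrite /padic_abs; case: eqVneq => //.
by rewrite (_ : _ - _ = -1 :> int)// exprN1 div1r.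
Qed.

Theorem theorem1p1 (R : realType)
  (Q2 : fieldType) (abs_Q2 : Q2 -> R) (i0 : {rmorphism rat -> Q2})
  (hQ2 : is_completion (padic_abs R 2) abs_Q2 i0)
  (Q2bar : closedFieldType) (abs_Q2bar : Q2bar -> R)
  (i1 : {rmorphism Q2 -> Q2bar})
  (hQ2bar : is_valued_algebraic_closure abs_Q2 abs_Q2bar i1)
  (C2 : fieldType) (abs_C2 : C2 -> R) (i2 : {rmorphism Q2bar -> C2})
  (hC2 : is_completion abs_Q2bar abs_C2 i2) :
  (forall (alpha beta : Q2bar) (q : rat),
      alpha <> 0 -> beta <> 0 -> alpha <> beta ->
      alpha / beta = i1 (i0 q) -> q <> - 2 -> q <> - (1 / 2) ->
      T (i2 alpha) `&` T (i2 beta) = set0)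
  /\
  (forall a : Q2bar, a <> 0 ->
      T (i2 a) `&` T (i2 (- 2 * a)) = [set i2 (- a ^+ 3)]).

Proof.
have vabs := completion_abs hC2.
have v2 : abs_C2 2 = 1 / 2.
  rewrite -(rmorph_nat i2) (completion_isometry hC2) -(rmorph_nat i1).
  rewrite (closure_extends hQ2bar) -(rmorph_nat i0) (completion_isometry hQ2).
  exact: padic_abs2.
have ratioP (alpha beta : Q2bar) (q : rat) (lambda : C2) :
    alpha <> 0 -> beta <> 0 -> alpha / beta = i1 (i0 q) ->
    T (i2 alpha) lambda -> T (i2 beta) lambda ->
    [\/ q = 1, q = - 2 | q = - (1 / 2)].
  move=> /eqP a0 /eqP b0 abq /T_cube_ratio[l0 pa] /T_cube_ratio[_ pb].
  apply: (preperiodic_cube_rat vabs v2 (i := i2 \o i1 \o i0) _ _ _ pa pb).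
  - by rewrite mulf_neq0 ?invr_neq0 ?expf_neq0 ?fmorph_eq0.
  - by rewrite mulf_neq0 ?invr_neq0 ?expf_neq0 ?fmorph_eq0.
  - by rewrite /= -abq mulrA -exprMn -rmorphM divfK.
split=> [alpha beta q a0 b0 ab abq qN2 qN12 | a /eqP a0].
  apply/seteqP; split=> // lambda [Ta Tb].
  case: (ratioP _ _ _ _ a0 b0 abq Ta Tb) => // q1.
  by apply: ab; move/eqP in b0; rewrite -[alpha](divfK b0) abq q1 !rmorph1 mul1r.
have ia0 : i2 a != 0 by rewrite fmorph_eq0.
have n2 : 2 != 0 :> C2 by apply: (nav_neq0 vabs); rewrite v2; lra.
apply/seteqP; split=> lambda /=;
  first case=> /T_cube_ratio[l0 pa] /T_cube_ratio[_ pb].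
  have t0 : i2 a ^+ 3 / lambda != 0 by rewrite mulf_neq0 ?invr_neq0 ?expf_neq0.
  have s0 : i2 (- 2 * a) ^+ 3 / lambda != 0.
    rewrite mulf_neq0 ?invr_neq0 ?expf_neq0//.
    by rewrite rmorphM rmorphN rmorph_nat mulf_neq0 ?oppr_eq0.
  have sE : i2 (- 2 * a) ^+ 3 / lambda = (- 2) ^+ 3 * (i2 a ^+ 3 / lambda).
    by rewrite rmorphM rmorphN rmorph_nat; ring.
  have N2 : abs_C2 (- 2) <= 1 / 2 by rewrite (navN vabs) v2.
  (* The ratio -2 is the extremal case: it forces [i2 a ^+ 3 / lambda = -1]. *)
  have [/(canRL (divfK l0)) E _] := preperiodic_cube_halve vabs v2 s0 t0 sE N2 pb pa.
  by rewrite rmorphN rmorphXn E mulN1r opprK.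
have n9 : 9 != 0 :> C2.
  rewrite (_ : 9 = 3 * 3) ?mulf_neq0//; last by ring.
    by apply: (nav_neq0 vabs); rewrite (nav3 vabs v2).
  by apply: (nav_neq0 vabs); rewrite (nav3 vabs v2).
move=> ->; rewrite rmorphN rmorphXn rmorphM rmorphN rmorph_nat; set b := i2 a.
have l0 : - b ^+ 3 <> 0 by apply/eqP; rewrite oppr_eq0 expf_neq0.
(* For [lambda = - b ^+ 3], [b] maps to the fixed point at infinity and [- 2 * b] to the fixed point
   0, its denominator being nonzero because 9 is. *)
split; split=> //.
  by exists 1%N, 2%N; split=> //=; rewrite subrr eqxx.
exists 1%N, 2%N; split=> //=.
have -> : (- 2 * b) ^+ 3 - b ^+ 3 = - (9 * b ^+ 3) by ring.
rewrite oppr_eq0 mulf_eq0 (negPf n9) expf_eq0/= (negPf ia0).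
have -> : (- 2 * b) ^+ 4 - 8 * - b ^+ 3 * (- 2 * b) = 0 by ring.
by rewrite mul0r /lattes !expr0n /= add0r (introF eqP l0) mulr0 subr0 mul0r.
Qed.
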